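(* The Banach space $C(\Delta)$ admits an equivalent norm such that its bidual norm (on $C(\Delta)^{**}$) is octahedral.
   Context: $\Delta=\{0,1\}^{\mathbb{N}}$ is the Cantor set and $C(\Delta)$ is the real Banach space of continuous real-valued functions on $\Delta$ with the supremum norm. A Banach space $X$ with unit sphere $S_X$ (or its norm) is called octahedral if for every finite-dimensional subspace $E$ of $X$ and every $\varepsilon>0$ there is $y\in S_X$ such that $\|x+y\|\ge(1-\varepsilon)(\|x\|+\|y\|)$ for all $x\in E$. *)

(* Defs.v *)
From HB Require Import structures.
From mathcomp Require Import all_boot all_order all_algebra.
From mathcomp Require Import all_classical all_reals all_analysis.

Set Implicit Arguments.
Unset Strict Implicit.
Unset Printing Implicit Defensive.

Import Order.TTheory GRing.Theory Num.Theory.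
Import numFieldNormedType.Exports.

Local Open Scope classical_set_scope.
Local Open Scope ring_scope.

Section ContinuousFunctions.
Variable R : realType.

(* C(Delta). An alias of the type of continuous functions, which has other
   topologies in the library; here the topology is that of the supremum norm. *)
Definition CDelta : Type := continuousType cantor_space R.

HB.instance Definition _ := Choice.copy CDelta (continuousType cantor_space R).

Definition CDelta_fun (f : CDelta) : cantor_space -> R := f.

Definition CDelta_pred : {pred cantor_space -> R} :=
  fun f => `[< continuous f >].

Let CDelta_sub (f : cantor_space -> R) (fP : f \in CDelta_pred) : CDelta :=
  mkcts (asboolW fP).

Let CDelta_rect (K : CDelta -> Type) :
  (forall f (fP : f \in CDelta_pred), K (CDelta_sub fP)) -> forall u, K u.
Proof.
move=> Ksub u; have uP : CDelta_fun u \in CDelta_pred.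
  by apply/asboolT; exact: cts_fun.
by suff -> : u = CDelta_sub uP by []; apply/continuousEP.
Qed.

HB.instance Definition _ :=
  @isSub.Build _ _ CDelta CDelta_fun CDelta_sub CDelta_rect (fun _ _ => erefl).

Lemma CDelta_submod : submod_closed CDelta_pred.
Proof.
split=> [|a f g /asboolP cf /asboolP cg]; apply/asboolT; first exact: cst_continuous.
by move=> x; apply: continuousD; [apply: continuousZr; exact: cf|exact: cg].
Qed.

HB.instance Definition _ :=
  GRing.isSubmodClosed.Build R (cantor_space -> R) CDelta_pred CDelta_submod.
HB.instance Definition _ := [SubChoice_isSubLmodule of CDelta by <:].

Definition sup_norm (f : CDelta) : R := sup [set `|f t| | t in [set: cantor_space]].

Lemma sup_norm_has_sup (f : CDelta) :
  has_sup [set `|f t| | t in [set: cantor_space]].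
Proof.
split; first by exists `|f point|; exists point.
have : compact ((fun t => `|f t|) @` [set: cantor_space]).
  apply: continuous_compact; last exact: cantor_space_compact.
  apply: continuous_subspaceT => t.
  by apply: continuous_comp; [exact: cts_fun|exact: norm_continuous].
move/compact_bounded => [M [_ /(_ (M + 1))]]; rewrite ltrDl ltr01 => /(_ isT) fM.
by exists (M + 1) => _ [t _ <-]; rewrite -[leLHS]normr_id; apply: fM; exists t.
Qed.

Lemma le_sup_norm (f : CDelta) t : `|f t| <= sup_norm f.
Proof. by apply: (ub_le_sup (sup_norm_has_sup f).2); exists t. Qed.

Lemma sup_norm_le (f : CDelta) M : (forall t, `|f t| <= M) -> sup_norm f <= M.
Proof.
by move=> fM; apply: ge_sup; [exact: (sup_norm_has_sup f).1|move=> _ [t _ <-]].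
Qed.

Let sup_normD f g : sup_norm (f + g) <= sup_norm f + sup_norm g.
Proof.
by apply: sup_norm_le => t; apply: (le_trans (ler_normD _ _)); apply: lerD;
  exact: le_sup_norm.
Qed.

Let sup_norm_eq0 f : sup_norm f = 0 -> f = 0.
Proof.
move=> f0; apply/val_inj/funext => t; apply/eqP; rewrite -normr_eq0 eq_le normr_ge0.
by rewrite andbT -f0; exact: le_sup_norm.
Qed.

Let sup_normZ (a : R) f : sup_norm (a *: f) = `|a| * sup_norm f.
Proof.
have le b g : sup_norm (b *: g) <= `|b| * sup_norm g.
  by apply: sup_norm_le => t; rewrite /= normrM ler_wpM2l ?le_sup_norm.
apply/eqP; rewrite eq_le le /=; have [->|a0] := eqVneq a 0.
  by rewrite normr0 mul0r (le_trans _ (le_sup_norm _ point)).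
by rewrite -ler_pdivlMl ?normr_gt0// -normfV -{1}[f](scalerK a0) le.
Qed.

HB.instance Definition _ :=
  Lmodule_isNormed.Build R CDelta sup_normD sup_normZ sup_norm_eq0.

End ContinuousFunctions.

Section Dual.
Variables (R : realType) (X : normedModType R).

(* R^o is R as a normed module over itself. *)
Definition dual_pred : {pred X -> R^o} :=
  fun phi => `[< linear phi /\ continuous phi >].

Record dual_space : Type := Dual { dual_fun :> X -> R^o; _ : dual_fun \in dual_pred }.

HB.instance Definition _ := [isSub for dual_fun].
HB.instance Definition _ := [Choice of dual_space by <:].

Lemma dual_submod : submod_closed dual_pred.
Proof.
split=> [|a f g /asboolP[lf cf] /asboolP[lg cg]]; apply/asboolT.
  by split=> [b x y|]; [rewrite scaler0 addr0|exact: cst_continuous].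
split=> [b x y|x]; last first.
  by apply: continuousD; [apply: continuousZr; exact: cf|exact: cg].
have addE u : (a *: f + g) u = a *: f u + g u by [].
rewrite !addE (lf b x y) (lg b x y) !scalerDr !scalerA (mulrC a b) -!addrA; congr (_ + _).
by rewrite addrCA.
Qed.

HB.instance Definition _ :=
  GRing.isSubmodClosed.Build R (X -> R^o) dual_pred dual_submod.
HB.instance Definition _ := [SubChoice_isSubLmodule of dual_space by <:].

Definition dual_norm (phi : dual_space) : R :=
  sup [set `|phi x| | x in [set x : X | `|x| <= 1]].

Lemma dual_linear (phi : dual_space) : linear phi.
Proof. by case: phi => f /= /asboolP[]. Qed.

Lemma dual_continuous (phi : dual_space) : continuous phi.
Proof. by case: phi => f /= /asboolP[]. Qed.

Lemma dual_norm_has_sup (phi : dual_space) :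
  has_sup [set `|phi x| | x in [set x : X | `|x| <= 1]].
Proof.
split; first by exists `|phi 0|, 0 => //=; rewrite normr0.
pose f : {linear X -> R^o} :=
  HB.pack (phi : X -> R^o) (GRing.isLinear.Build _ _ _ _ _ (dual_linear phi)).
have /linear_bounded_continuous/bounded_funP/(_ 1)[M fM] : continuous f.
  exact: dual_continuous.
by exists M => _ [x x1 <-]; exact: fM.
Qed.

Lemma le_dual_norm (phi : dual_space) x : `|phi x| <= dual_norm phi * `|x|.
Proof.
have phiZ a y : phi (a *: y) = a * phi y.
  have phi0 : phi 0 = 0 by have := dual_linear phi (-1) 0 0;
    rewrite !scaleN1r oppr0 addr0 addNr.
  by have := dual_linear phi a y 0; rewrite !addr0 phi0 addr0.
have [->|x0] := eqVneq x 0.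
  by rewrite -(scale0r 0) phiZ mul0r scale0r !normr0 mulr0.
have nx : 0 < `|x| by rewrite normr_gt0.
rewrite -ler_pdivrMr// mulrC.
have -> : `|x|^-1 * `|phi x| = `|phi (`|x|^-1 *: x)|.
  by rewrite phiZ normrM gtr0_norm// invr_gt0.
apply: (ub_le_sup (dual_norm_has_sup phi).2); exists (`|x|^-1 *: x) => //=.
by rewrite normrZ normfV normr_id mulVf ?normr_eq0.
Qed.

Lemma dual_norm_le (phi : dual_space) M :
  (forall x, `|x| <= 1 -> `|phi x| <= M) -> dual_norm phi <= M.
Proof.
by move=> fM; apply: ge_sup;
  [exact: (dual_norm_has_sup phi).1|move=> _ [x x1 <-]; exact: fM].
Qed.

Let le_dual_norm1 (phi : dual_space) x : `|x| <= 1 -> `|phi x| <= dual_norm phi.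
Proof.
by move=> x1; apply: (ub_le_sup (dual_norm_has_sup phi).2); exists x.
Qed.

Let dual_normD phi psi : dual_norm (phi + psi) <= dual_norm phi + dual_norm psi.
Proof.
by apply: dual_norm_le => x x1; apply: (le_trans (ler_normD _ _)); apply: lerD;
  exact: le_dual_norm1.
Qed.

Let dual_norm_eq0 phi : dual_norm phi = 0 -> phi = 0.
Proof.
move=> phi0; apply/val_inj/funext => x; apply/eqP; rewrite -normr_eq0 eq_le normr_ge0.
by rewrite andbT (le_trans (le_dual_norm phi x))// phi0 mul0r.
Qed.

Let dual_normZ (a : R) phi : dual_norm (a *: phi) = `|a| * dual_norm phi.
Proof.
have le b psi : dual_norm (b *: psi) <= `|b| * dual_norm psi.
  by apply: dual_norm_le => x x1; rewrite [`|_|]normrM ler_wpM2l ?le_dual_norm1.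
apply/eqP; rewrite eq_le le /=; have [->|a0] := eqVneq a 0.
  rewrite normr0 mul0r (le_trans (normr_ge0 (((0 : R) *: phi : dual_space) 0)))//.
  by rewrite le_dual_norm1 ?normr0.
by rewrite -ler_pdivlMl ?normr_gt0// -normfV -{1}[phi](scalerK a0) le.
Qed.

HB.instance Definition _ :=
  Lmodule_isNormed.Build R dual_space dual_normD dual_normZ dual_norm_eq0.

End Dual.

Section Renorming.
Variables (R : realType) (X : normedModType R).

Record equivalent_norm (N : X -> R) : Prop := EquivalentNorm {
  equivalent_normD : forall x y, N (x + y) <= N x + N y;
  equivalent_normZ : forall (a : R) x, N (a *: x) = `|a| * N x;
  equivalent_norm_eq0 : forall x, N x = 0 -> x = 0;
  equivalent_norm_bounds : exists a b : R,
    [/\ 0 < a, 0 < b & forall x, a * `|x| <= N x <= b * `|x|]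
}.

(* The vector space X normed by N; the norm inherited from X is forgotten. *)
Definition renormed (N : X -> R) (hN : equivalent_norm N) : Type := X.

Variables (N : X -> R) (hN : equivalent_norm N).

HB.instance Definition _ := GRing.Lmodule.copy (renormed hN) X.
HB.instance Definition _ := Lmodule_isNormed.Build R (renormed hN)
  (equivalent_normD hN) (equivalent_normZ hN) (equivalent_norm_eq0 hN).

End Renorming.

(* The span of a finite family (not required to be free; n = 0 gives {0}). *)
Definition fin_dim_subspace (R : realType) (X : normedModType R) (E : set X) :=
  exists (n : nat) (v : 'I_n -> X),
    E = [set \sum_(i < n) c i *: v i | c in [set: 'I_n -> R]].

Definition octahedral (R : realType) (X : normedModType R) :=
  forall (E : set X) (eps : R), fin_dim_subspace E -> 0 < eps ->
  exists2 y : X, `|y| = 1 &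
    forall x, E x -> (1 - eps) * (`|x| + `|y|) <= `|x + y|.

(* Main.v *)
(** Let r_j = +-1 be the Rademacher functions on Delta and w_theta the product
    measures giving each coordinate i the value theta_i with probability 3/4.
    Renorm C(Delta) by N f = dist (f, span r_j) + sup_theta |w_theta f|; the second
    term is the l_1 norm (halved) on span r_j, so N is an equivalent norm.
    A functional phi <= N is, by Hahn-Banach, the sum of one killing every r_j and of
    a mean of signed measures +-w_theta. Replacing theta_j by the sign in this mean
    gives psi_j <= N with psi_j (2 r_j) = 1. The differences psi_j - phi have
    independent densities with respect to each w_theta, so a sum of n of them has norm
    O(sqrt n), and hence psi_j -> phi weakly along a subsequence. Evaluating F in the
    bidual at psi_j shows that the norm of F + 2 r_j comes close to that of F plus 1,
    simultaneously for finitely many F; a finite net of a ball of the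
    finite-dimensional subspace concludes.
    The w_theta are only used through their finite-dimensional marginals, the supremum
    over theta being replaced by an upper limit as the depth grows. *)
From HB Require Import structures.
Require Import Defs.
From mathcomp Require Import all_boot all_order all_algebra.
From mathcomp Require Import all_classical all_reals all_analysis.
From mathcomp Require Import ring lra.

Set Implicit Arguments.
Unset Strict Implicit.
Unset Printing Implicit Defensive.

Import Order.TTheory GRing.Theory Num.Theory.
Import numFieldNormedType.Exports.

Local Open Scope classical_set_scope.
Local Open Scope ring_scope.

(** * Biased product measures on finitely many coordinates, and changes of bias *)

Section BiasedExpectation.
Variable R : realType.
Implicit Types (f g : (nat -> bool) -> R) (theta t : nat -> bool).

Definition upd t j b : nat -> bool := fun i => if i == j then b else t i.

Definition coord_mean j b f : (nat -> bool) -> R :=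
  fun t => 3 / 4 * f (upd t j b) + 1 / 4 * f (upd t j (~~ b)).

(* Expectation when the coordinates i < n are independent and equal to theta i
   with probability 3/4, the other coordinates being frozen to false. *)
Fixpoint expect n theta f : R :=
  if n is m.+1 then expect m theta (coord_mean m (theta m) f) else f xpred0.

Lemma upd_eq t j b : upd t j b j = b.
Proof. by rewrite /upd eqxx. Qed.

Lemma upd_neq t j b i : i != j -> upd t j b i = t i.
Proof. by rewrite /upd => /negPf ->. Qed.

Lemma expect_lin n theta a f g :
  expect n theta (fun t => a * f t + g t) = a * expect n theta f + expect n theta g.
Proof.
elim: n f g => [//|n IH] f g /=; rewrite -IH; congr expect; apply/funext => t.
by rewrite /coord_mean; ring.
Qed.

Lemma expect_cst n theta c : expect n theta (fun=> c) = c.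
Proof.
elim: n => [//|n {2}<-] /=; congr expect; apply/funext => t.
by rewrite /coord_mean; field.
Qed.

Lemma expectZ n theta a f : expect n theta (fun t => a * f t) = a * expect n theta f.
Proof.
have := expect_lin n theta a f (fun=> 0); rewrite expect_cst addr0 => <-.
by congr expect; apply/funext => t; rewrite addr0.
Qed.

Lemma expectD n theta f g :
  expect n theta (fun t => f t + g t) = expect n theta f + expect n theta g.
Proof.
have := expect_lin n theta 1 f g; rewrite mul1r => <-.
by congr expect; apply/funext => t; rewrite mul1r.
Qed.

Lemma le_expect n theta f g :
  (forall t, f t <= g t) -> expect n theta f <= expect n theta g.
Proof.
elim: n f g => [|n IH] f g fg /=; first exact: fg.
by apply: IH => t; rewrite /coord_mean lerD// ler_wpM2l// divr_ge0.
Qed.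

Lemma normr_expect_le n theta f g :
  (forall t, `|f t| <= g t) -> `|expect n theta f| <= expect n theta g.
Proof.
move=> fg; rewrite ler_norml -mulN1r -expectZ; apply/andP; split; apply: le_expect => t.
  by rewrite mulN1r lerNl (le_trans _ (fg t))// -normrN ler_norm.
by rewrite (le_trans _ (fg t))// ler_norm.
Qed.

Lemma expect_sum n theta (m : nat) (F : nat -> (nat -> bool) -> R) :
  expect n theta (fun t => \sum_(j < m) F j t) = \sum_(j < m) expect n theta (F j).
Proof.
elim: m => [|m IH].
  rewrite big_ord0 -[RHS](expect_cst n theta).
  by congr expect; apply/funext => t; rewrite big_ord0.
rewrite big_ord_recr/= -IH -expectD.
by congr expect; apply/funext => t; rewrite big_ord_recr.
Qed.

Lemma expect_coord n theta j (h : bool -> R) : (j < n)%N ->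
  expect n theta (fun t => h (t j)) = 3 / 4 * h (theta j) + 1 / 4 * h (~~ theta j).
Proof.
elim: n => [//|n IH] /=; rewrite ltnS leq_eqVlt => /predU1P[->|jn].
  rewrite -[RHS](expect_cst n theta); congr expect; apply/funext => t.
  by rewrite /coord_mean !upd_eq.
rewrite -IH//; congr expect; apply/funext => t.
by rewrite /coord_mean !upd_neq ?ltn_eqF//; field.
Qed.

Lemma expect_eq_bias n theta theta' f : (forall i, (i < n)%N -> theta i = theta' i) ->
  expect n theta f = expect n theta' f.
Proof.
elim: n f => [//|n IH] f e /=; rewrite e// IH// => i /ltnW lin; exact: e.
Qed.

(* The density at coordinate value b of the bias towards c with respect to the
   bias towards a. *)
Definition tilt (a c b : bool) : R :=
  if a == c then 1 else if b == c then 3 else 1 / 3.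

(** Only the factor at coordinate [j] of the product measure changes; [tilt] is the ratio of its new
    weights to its old ones. *)
Lemma expect_upd n theta j c f : (j < n)%N ->
  expect n (upd theta j c) f = expect n theta (fun t => f t * tilt (theta j) c (t j)).
Proof.
elim: n f => [//|n IH] f /=; rewrite ltnS leq_eqVlt => /predU1P[{IH}->|jn].
  rewrite (@expect_eq_bias _ _ theta); last first.
    by move=> i lin; rewrite upd_neq ?ltn_eqF.
  congr expect; apply/funext => t; rewrite /coord_mean !upd_eq /tilt.
  by case: (theta n); case: c => /=; field.
rewrite IH// upd_neq ?gtn_eqF//; congr expect; apply/funext => t.
by rewrite /coord_mean !upd_neq ?ltn_eqF//; ring.
Qed.

(** Density, with respect to the bias [theta], of the signed measure that sums [b j] times the
    change caused by resetting [theta j] to [sigma j]. *)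
Definition tilt_sum (theta sigma : nat -> bool) (b : nat -> R) m t : R :=
  \sum_(j < m) b j * (tilt (theta j) (sigma j) (t j) - 1).

(* The tilts are independent of mean 1, so the variances add up. *)
Lemma expect_tilt_sum_sqr theta sigma b m n : (m <= n)%N ->
  (forall j, `|b j| <= 1) ->
  expect n theta (fun t => tilt_sum theta sigma b m t ^+ 2) <= 2 * m%:R.
Proof.
move=> mn b1; have updS t k c m' : (m' <= k)%N ->
    tilt_sum theta sigma b m' (upd t k c) = tilt_sum theta sigma b m' t.
  move=> mk; apply: eq_bigr => j _; rewrite upd_neq//.
  by rewrite ltn_eqF// (leq_trans (ltn_ord j)).
elim: n => [|n IH] in m mn *.
  move: mn; rewrite leqn0 => /eqP -> /=.
  by rewrite /tilt_sum big_ord0 expr0n mulr0.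
move: mn; rewrite leq_eqVlt => /predU1P[->|]; last first.
  rewrite ltnS => mn; apply: le_trans (IH _ mn) => /=; apply: le_expect => t.
  by rewrite /coord_mean !updS//; lra.
have {IH} := IH n (leqnn n); rewrite -(lerD2r 2) => H.
apply: le_trans (_ : _ <= 2 * n%:R + 2) _; last by rewrite -natr1; lra.
apply: le_trans H; rewrite -[X in _ <= _ + X](expect_cst n theta) -expectD /=.
apply: le_expect => t; rewrite /coord_mean /tilt_sum !big_ord_recr/=.
rewrite -!/(tilt_sum _ _ _ _ _) !updS// !upd_eq /tilt.
(* The cross term averages to 0, and the new square to [b n ^+ 2] times 3/4 (1/3 - 1)^2 + 1/4 (3 -
   1)^2 = 4/3, or to 0 for equal biases; 2 is a rough bound. *)
have bb : (b n) ^+ 2 <= 1 by rewrite -real_normK ?num_real// exprn_ile1.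
by move: bb; case: (theta n); case: (sigma n) => /=; nra.
Qed.

(* AM-GM: [|z| <= (z^2 / k + k) / 2]. *)
Lemma expect_tilt_sum_le theta sigma b k n f M : (k ^ 2 <= n)%N ->
  (forall j, `|b j| <= 1) -> (forall t, `|f t| <= M) ->
  `|expect n theta (fun t => f t * tilt_sum theta sigma b (k ^ 2) t)| <= 2 * M * k%:R.
Proof.
move=> kn b1 fM; have M0 : 0 <= M := le_trans (normr_ge0 _) (fM xpred0).
have [->|k0] := eqVneq k 0%N.
  rewrite mulr0 normr_le0; apply/eqP; rewrite -[RHS](expect_cst n theta).
  by congr expect; apply/funext => t; rewrite /tilt_sum big_ord0 mulr0.
have {}k0 : 0 < k%:R :> R by rewrite ltr0n lt0n.
apply: le_trans (_ : _ <= expect n theta (fun t =>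
    M / (2 * k%:R) * tilt_sum theta sigma b (k ^ 2) t ^+ 2 + M * k%:R / 2)) _.
  apply: normr_expect_le => t; rewrite normrM.
  apply: le_trans (ler_wpM2r (normr_ge0 _) (fM t)) _.
  set z := tilt_sum _ _ _ _ _; rewrite -[z ^+ 2]real_normK ?num_real//.
  have -> : M / (2 * k%:R) * `|z| ^+ 2 + M * k%:R / 2 =
            M * ((`|z| - k%:R) ^+ 2 / (2 * k%:R) + `|z|) by field; lra.
  by rewrite ler_wpM2l// lerDr divr_ge0 ?sqr_ge0//; lra.
rewrite expectD expectZ expect_cst.
have := expect_tilt_sum_sqr theta sigma kn b1; rewrite natrX => V.
have c0 : 0 <= M / (2 * k%:R) by rewrite divr_ge0// mulr_ge0// ltW.
have e : M / (2 * k%:R) * (2 * k%:R ^+ 2) = M * k%:R by field; lra.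
apply: le_trans (lerD (ler_wpM2l c0 V) (lexx _)) _.
have Mk : 0 <= M * k%:R by rewrite mulr_ge0// ltW.
by rewrite e; lra.
Qed.

End BiasedExpectation.

(** * The Hahn-Banach theorem for sublinear functionals *)

Section HahnBanach.
Variables (R : realType) (V : lmodType R).
Implicit Types (p q : V -> R) (E : V -> set R).

Record sublinear p : Prop := Sublinear {
  sublinearD : forall x y, p (x + y) <= p x + p y;
  sublinearZ_le : forall a x, 0 < a -> p (a *: x) <= a * p x
}.

Lemma sublinear0 p : sublinear p -> p 0 = 0.
Proof.
move=> [pD pZ]; have := pD 0 0; have := pZ (1 / 2) 0.
by rewrite scaler0 addr0 => /(_ (ltac:(lra))); lra.
Qed.

Lemma sublinearZ p a x : sublinear p -> 0 < a -> p (a *: x) = a * p x.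
Proof.
move=> [pD pZ] a0; apply/eqP; rewrite eq_le pZ//=.
by rewrite -ler_pdivlMl// -{1}[x](scalerK (lt0r_neq0 a0)) pZ// invr_gt0.
Qed.

Lemma sublinear_geN p x : sublinear p -> - p (- x) <= p x.
Proof.
move=> sp; have := sublinearD sp x (- x).
by rewrite subrr sublinear0//; lra.
Qed.

(** Common template for chain infima, the auxiliary functional of Hahn-Banach, upper limits,
    distances and infimal convolutions. *)
Lemma inf_sublinear E :
  (forall x, E x !=set0) -> (forall x, has_lbound (E x)) ->
  (forall x y r s, E x r -> E y s -> exists2 t, E (x + y) t & t <= r + s) ->
  (forall a x r, 0 < a -> E x r -> exists2 t, E (a *: x) t & t <= a * r) ->
  sublinear (fun x => inf (E x)).
Proof.
move=> E0 lE ED EZ; split=> [x y|a x a0].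
  rewrite -lerBlDr; apply: lb_le_inf => // r Er.
  rewrite lerBlDr -lerBlDl; apply: lb_le_inf => // s Es; rewrite lerBlDl.
  by have [t Et] := ED _ _ _ _ Er Es; apply: le_trans; exact: ge_inf.
rewrite -ler_pdivrMl//; apply: lb_le_inf => // r Er; rewrite ler_pdivrMl//.
by have [t Et] := EZ _ _ _ a0 Er; apply: le_trans; exact: ge_inf.
Qed.

(** Zorn's lemma applies because a nonempty chain has a pointwise infimum, kept finite by the lower
    bound [- p (- x)]. *)
Lemma minimal_sublinear p : sublinear p ->
  exists q, [/\ sublinear q, forall x, q x <= p x &
    forall q', sublinear q' -> (forall x, q' x <= q x) -> q' = q].
Proof.
move=> sp; pose T := {q | sublinear q /\ forall x, q x <= p x}.
pose ge (q r : T) := `[< forall x, sval r x <= sval q x >].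
have [|||A totA|[q [sq qp]] qmin] := @Zorn T ge.
- by move=> q; apply/asboolP.
- by move=> q r s /asboolP qr /asboolP rs; apply/asboolP => x; exact: le_trans (qr x).
- move=> [q ?] [r ?] /asboolP/= qr /asboolP/= rq; apply/eq_exist/funext => x.
  by apply/eqP; rewrite eq_le qr rq.
- have [[r0 Ar0]|A0] := pselect (A !=set0); last first.
    have pp : sublinear p /\ forall x, p x <= p x by [].
    by exists (exist _ p pp) => s As; exfalso; apply: A0; exists s.
  pose E x := [set sval r x | r in A].
  have lE x : has_lbound (E x).
    exists (- p (- x)) => _ [[r [sr rp]] _ <-] /=.
    by rewrite (le_trans _ (sublinear_geN x sr))// lerN2.
  have sE : sublinear (fun x => inf (E x)).
    apply: inf_sublinear => //.
    - by move=> x; exists (sval r0 x), r0.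
    (* Of two members of the chain, the smaller one lies below both, so its own subadditivity
       suffices. *)
    - move=> x y _ _ [r Ar <-] [s As <-]; case: (totA r s Ar As) => /asboolP rs.
        by exists (sval s (x + y)); [exists s|rewrite (le_trans (sublinearD (svalP s).1 _ _))// lerD].
      by exists (sval r (x + y)); [exists r|rewrite (le_trans (sublinearD (svalP r).1 _ _))// lerD].
    - move=> a x _ a0 [r Ar <-]; exists (sval r (a *: x)); first by exists r.
      exact: sublinearZ_le (svalP r).1 _ _ a0.
  have Ep x : inf (E x) <= p x.
    by rewrite (le_trans _ ((svalP r0).2 x))//; apply: ge_inf => //; exists r0.
  exists (exist (fun q => sublinear q /\ forall x, q x <= p x) _ (conj sE Ep)) => s As; apply/asboolP => x /=.
  by apply: ge_inf => //; exists s.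
exists q; split=> // q' sq' q'q.
have q'p x : q' x <= p x by exact: le_trans (q'q x) (qp x).
have := qmin (exist (fun q => sublinear q /\ forall x, q x <= p x) q' (conj sq' q'p)).
by move=> /(_ (asboolT q'q)) /(congr1 sval).
Qed.

(* A minimal sublinear functional q is linear: it cannot exceed the sublinear
   functional y |-> inf_(t >= 0) (q (y + t x) - t q x). *)
Theorem hahn_banach p : sublinear p ->
  exists m : {scalar V}, forall x, m x <= p x.
Proof.
move=> /minimal_sublinear[q [sq qp qmin]].
have qge x y : q x + q y <= q (y + x).
  pose E z := [set q (z + t *: x) - t * q x | t in [set t | 0 <= t]].
  have lE z : has_lbound (E z).
    exists (- q (- z)) => _ [t /= t0 <-].
    have := sublinearD sq (z + t *: x) (- z); rewrite addrAC subrr add0r.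
    have [t_gt0|t_le0|<-] := ltgtP 0 t; last 1 first.
    - by rewrite scale0r addr0 mul0r sublinear0// subr0; lra.
    - by rewrite (sublinearZ _ sq)//; lra.
    - by rewrite leNgt t_le0 in t0.
  have qE z t : 0 <= t -> inf (E z) <= q (z + t *: x) - t * q x.
    by move=> t0; apply: ge_inf => //; exists t.
  have /qmin EE : sublinear (fun z => inf (E z)).
    apply: inf_sublinear => // [z|z w _ _ [t /= t0 <-] [s /= s0 <-]|a z _ a0 [t /= t0 <-]].
    - by exists (q (z + 0 *: x) - 0 * q x), 0 => /=.
    - exists (q (z + w + (t + s) *: x) - (t + s) * q x).
        by exists (t + s) => //=; rewrite addr_ge0.
      by have := sublinearD sq (z + t *: x) (w + s *: x);
        rewrite addrACA -scalerDl; lra.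
    - exists (q (a *: z + (a * t) *: x) - (a * t) * q x).
        by exists (a * t) => //=; rewrite mulr_ge0// ltW.
      by rewrite -scalerA -scalerDr mulrBr mulrA lerB// sublinearZ_le.
  (* [t = 1] turns [inf (E y) = q y] into superadditivity; [t = 0] gives the domination by [q] that
     minimality asks for. *)
  have := qE y 1 ler01; rewrite -[inf _]/((fun z => inf (E z)) y) EE.
    by rewrite scale1r mul1r; lra.
  by move=> z; have := qE z 0 (lexx _); rewrite scale0r addr0 mul0r subr0.
have qD x y : q (x + y) = q x + q y.
  by apply/eqP; rewrite eq_le sublinearD//= (addrC x y) qge.
have qN x : q (- x) = - q x.
  by have := qD x (- x); rewrite subrr sublinear0//; lra.
have q_lin : scalar q.
  move=> a x y; rewrite qD; congr (_ + _).
  case: (ltgtP a 0) => [a0|a0|->]; last by rewrite scale0r mul0r sublinear0.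
    have := sublinearZ x sq (_ : 0 < - a); rewrite oppr_gt0 => /(_ a0).
    by rewrite scaleNr qN; lra.
  by rewrite sublinearZ.
pose m : {scalar V} := HB.pack q (GRing.isLinear.Build R V R *%R q q_lin).
by exists m.
Qed.

End HahnBanach.

(** * Upper limits of bounded functions of a configuration as the depth grows *)

Section LimsupFunctional.
Variable R : realType.

(* A depth n, a bias theta and a sign: the index of the functional
   f |-> +- expect n theta f. *)
Definition config : Type := (nat * (nat -> bool) * bool)%type.

Definition bconfig_pred : {pred config -> R} :=
  fun g => `[< exists M, forall c, `|g c| <= M >].

Record bconfig : Type :=
  BConfig { bconfig_val :> config -> R; _ : bconfig_val \in bconfig_pred }.

HB.instance Definition _ := [isSub for bconfig_val].
HB.instance Definition _ := [Choice of bconfig by <:].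

Lemma bconfig_submod : submod_closed bconfig_pred.
Proof.
split=> [|a f g /asboolP[M fM] /asboolP[N gN]]; apply/asboolT.
  by exists 0 => c; rewrite normr0.
exists (`|a| * M + N) => c; apply: (le_trans (ler_normD _ _)).
by rewrite lerD// normrM ler_wpM2l.
Qed.

HB.instance Definition _ :=
  GRing.isSubmodClosed.Build R (config -> R) bconfig_pred bconfig_submod.
HB.instance Definition _ := [SubChoice_isSubLmodule of bconfig by <:].

Implicit Types g : bconfig.

Lemma bconfigP g : exists M, forall c, `|g c| <= M.
Proof. by case: g => g /= /asboolP. Qed.

Definition eventual_ub g : set R :=
  [set M | exists n, forall c, (n <= c.1.1)%N -> g c <= M].

(** The upper limit, as the depth grows, of the supremum over all biases and signs. Discarding small
    depths ensures that any given coordinate is eventually averaged. *)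
Definition limsup_sup g : R := inf (eventual_ub g).

Lemma eventual_ub_lb g M : (forall n, exists2 c : config, (n <= c.1.1)%N & M <= g c) ->
  lbound (eventual_ub g) M.
Proof. by move=> Mg K [n gK]; have [c nc Mc] := Mg n; exact: le_trans Mc (gK _ nc). Qed.

Lemma has_lbound_eventual_ub g : has_lbound (eventual_ub g).
Proof.
have [M gM] := bconfigP g; exists (- M); apply: eventual_ub_lb => n.
by exists (n, xpred0, true) => //=; have := gM (n, xpred0, true); rewrite ler_norml => /andP[].
Qed.

Lemma eventual_ub_neq0 g : eventual_ub g !=set0.
Proof.
have [M gM] := bconfigP g; exists M, 0%N => c _.
exact: le_trans (ler_norm _) (gM c).
Qed.

Lemma limsup_sup_le g M n : (forall c, (n <= c.1.1)%N -> g c <= M) -> limsup_sup g <= M.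
Proof.
by move=> gM; apply: ge_inf; [exact: has_lbound_eventual_ub|exists n].
Qed.

Lemma limsup_sup_ge g M : (forall n, exists2 c : config, (n <= c.1.1)%N & M <= g c) ->
  M <= limsup_sup g.
Proof. by move=> Mg; apply: lb_le_inf; [exact: eventual_ub_neq0|exact: eventual_ub_lb]. Qed.

Lemma limsup_sup_sublinear : sublinear limsup_sup.
Proof.
apply: inf_sublinear.
- exact: eventual_ub_neq0.
- exact: has_lbound_eventual_ub.
- move=> f g r s [n fr] [m gs]; exists (r + s) => //.
  by exists (maxn n m) => c; rewrite geq_max => /andP[nc mc]; exact: lerD (fr _ nc) (gs _ mc).
- move=> a f r a0 [n fr]; exists (a * r) => //.
  by exists n => c nc; exact: (ler_wpM2l (ltW a0) (fr _ nc) : a * f c <= a * r).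
Qed.

(** Once bias and sign are aligned, the signed mean of the [j]-th Rademacher function is 1/2 at
    every depth above [j]. *)
Definition force j (c : config) : config := (c.1.1, upd c.1.2 j c.2, c.2).

Lemma forced_subproof j g : g \o force j \in bconfig_pred.
Proof. by have [M gM] := bconfigP g; apply/asboolT; exists M => c; exact: gM. Qed.

Definition forced j g : bconfig := BConfig (forced_subproof j g).

Lemma forced_linear j : linear (forced j).
Proof. by move=> a f g; apply/val_inj/funext. Qed.

HB.instance Definition _ j :=
  GRing.isLinear.Build R bconfig bconfig _ (forced j) (forced_linear j).

(** [force j] preserves the depth, so eventual upper bounds survive composition with it. *)
Lemma limsup_sup_forced j g : limsup_sup (forced j g) <= limsup_sup g.
Proof.
apply: lb_le_inf; first exact: eventual_ub_neq0.
by move=> M [n gM]; apply: (@limsup_sup_le _ _ n) => c nc; exact: gM.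
Qed.

End LimsupFunctional.

(** * The Rademacher functions and the equivalent norm *)

Section Norm.
Variable R : realType.
Local Notation X := (CDelta R).
Implicit Types (f : X) (a : nat -> R).

Definition sgb (s : bool) : R := if s then 1 else -1.

Lemma normr_sgb s : `|sgb s| = 1.
Proof. by case: s; rewrite /= ?normrN normr1. Qed.

Lemma rademacher_continuous j : continuous (fun t : cantor_space => sgb (t j)).
Proof.
move=> t; apply: (@continuous_comp _ _ _ (fun t : cantor_space => t j) sgb).
  exact: (@proj_continuous nat (fun=> bool) j).
move=> A /nbhs_singleton As; have sA : [set t j] `<=` sgb @^-1` A by move=> _ ->.
exact: filterS sA (discrete_set1 (t j)).
Qed.

Definition rademacher j : X := mkcts (@rademacher_continuous j).

Definition rademacher_comb a n : X := \sum_(j < n) a j *: rademacher j.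

Lemma rademacher_combE a n (t : cantor_space) :
  rademacher_comb a n t = \sum_(j < n) a j * sgb (t j).
Proof.
elim: n => [|n IH]; first by rewrite /rademacher_comb !big_ord0.
by rewrite /rademacher_comb !big_ord_recr/= -IH.
Qed.

Lemma rademacher_comb_widen a n m : (n <= m)%N ->
  rademacher_comb a n = rademacher_comb (fun i => if (i < n)%N then a i else 0) m.
Proof.
move=> nm; rewrite /rademacher_comb (big_ord_widen m (fun j => a j *: rademacher j))//.
rewrite big_mkcond; apply: eq_bigr => j _.
by case: ifP => //; rewrite scale0r.
Qed.

Lemma rademacher_combD a a' n :
  rademacher_comb (fun i => a i + a' i) n = rademacher_comb a n + rademacher_comb a' n.
Proof. by rewrite -big_split; apply: eq_bigr => j _; rewrite scalerDl. Qed.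

Lemma rademacher_combZ c a n :
  rademacher_comb (fun i => c * a i) n = c *: rademacher_comb a n.
Proof. by rewrite scaler_sumr; apply: eq_bigr => j _; rewrite scalerA. Qed.

Lemma normr_rademacher_comb a n : `|rademacher_comb a n| <= \sum_(j < n) `|a j|.
Proof.
apply: sup_norm_le => t; rewrite rademacher_combE (le_trans (ler_norm_sum _ _ _))//.
by apply: ler_sum => j _; rewrite normrM normr_sgb mulr1.
Qed.

Definition comb_dists f : set R := [set r | exists n a, r = `|f - rademacher_comb a n| ].

Definition comb_dist f : R := inf (comb_dists f).

Lemma comb_dists_neq0 f : comb_dists f !=set0.
Proof. by exists (`|f - rademacher_comb (fun=> 0) 0|), 0%N, (fun=> 0). Qed.

Lemma has_lbound_comb_dists f : has_lbound (comb_dists f).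
Proof. by exists 0 => _ [n [a ->]]; exact: normr_ge0. Qed.

Lemma comb_dist_le f n a : comb_dist f <= `|f - rademacher_comb a n|.
Proof. by apply: ge_inf; [exact: has_lbound_comb_dists|exists n, a]. Qed.

Lemma comb_dist_ge0 f : 0 <= comb_dist f.
Proof.
apply: lb_le_inf; first exact: comb_dists_neq0.
by move=> _ [n [a ->]]; exact: normr_ge0.
Qed.

Lemma comb_distZ_le c f : comb_dist (c *: f) <= `|c| * comb_dist f.
Proof.
have [->|c0] := eqVneq c 0.
  rewrite scale0r normr0 mul0r (le_trans (comb_dist_le 0 0 (fun=> 0)))//.
  by rewrite /rademacher_comb big_ord0 subrr normr0.
rewrite -ler_pdivrMl ?normr_gt0//; apply: lb_le_inf; first exact: comb_dists_neq0.
move=> _ [n [a ->]]; rewrite ler_pdivrMl ?normr_gt0// -normrZ scalerBr -rademacher_combZ.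
exact: comb_dist_le.
Qed.

Lemma comb_dist_sublinear : sublinear comb_dist.
Proof.
apply: inf_sublinear.
- exact: comb_dists_neq0.
- exact: has_lbound_comb_dists.
- move=> f g _ _ [n [a ->]] [m [b ->]].
  rewrite (rademacher_comb_widen a (leq_maxl n m)) (rademacher_comb_widen b (leq_maxr n m)).
  move: (fun i => if (i < n)%N then a i else 0) (fun i => if (i < m)%N then b i else 0).
  move=> a' b'.
  exists (`|f + g - rademacher_comb (fun i => a' i + b' i) (maxn n m)|).
    by eexists; eexists.
  by rewrite rademacher_combD opprD addrACA ler_normD.
- move=> c f _ c0 [n [a ->]]; exists (`|c *: f - rademacher_comb (fun i => c * a i) n|).
    by eexists; eexists.
  by rewrite rademacher_combZ -scalerBr normrZ gtr0_norm.
Qed.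

Lemma signed_expect_subproof f :
  (fun c : config => sgb c.2 * expect c.1.1 c.1.2 f) \in @bconfig_pred R.
Proof.
apply/asboolT; exists `|f| => c; rewrite normrM normr_sgb mul1r.
rewrite -[leRHS](expect_cst c.1.1 c.1.2); apply: normr_expect_le => t.
exact: le_sup_norm.
Qed.

Definition signed_expect f : bconfig R := BConfig (signed_expect_subproof f).

Lemma signed_expect_linear : linear signed_expect.
Proof.
move=> a f g; apply/val_inj/funext => c.
change (sgb c.2 * expect c.1.1 c.1.2 (fun t => a * f t + g t) =
  a * (sgb c.2 * expect c.1.1 c.1.2 f) + sgb c.2 * expect c.1.1 c.1.2 g).
by rewrite expect_lin; ring.
Qed.

HB.instance Definition _ :=
  GRing.isLinear.Build R X (bconfig R) _ signed_expect signed_expect_linear.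

(** The sign in a configuration makes this the upper limit of the suprema over [theta] of
    [|expect n theta f|], hence a seminorm. *)
Definition bias_norm f : R := limsup_sup (signed_expect f).

Lemma bias_norm_le f M : (forall n theta, `|expect n theta f| <= M) -> bias_norm f <= M.
Proof.
move=> fM; apply: (@limsup_sup_le _ _ _ 0) => c _ /=; rewrite (le_trans (ler_norm _))//.
by rewrite normrM normr_sgb mul1r.
Qed.

Lemma bias_norm_le_norm f : bias_norm f <= `|f|.
Proof.
apply: bias_norm_le => n theta; rewrite -[leRHS](expect_cst n theta).
by apply: normr_expect_le => t; exact: le_sup_norm.
Qed.

Lemma bias_norm_sublinear : sublinear bias_norm.
Proof.
split=> [f g|a f a0]; rewrite /bias_norm.
  by rewrite raddfD; exact: sublinearD (limsup_sup_sublinear R) _ _.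
by rewrite linearZ; exact: sublinearZ_le (limsup_sup_sublinear R) _ _ a0.
Qed.

Lemma bias_normN f : bias_norm (- f) = bias_norm f.
Proof.
have le g : bias_norm (- g) <= bias_norm g.
  apply: lb_le_inf; first exact: eventual_ub_neq0.
  move=> M [n gM]; apply: (@limsup_sup_le _ _ _ n) => c nc.
  rewrite raddfN; have := gM (c.1, ~~ c.2) nc; apply: le_trans.
  change (- (sgb c.2 * expect c.1.1 c.1.2 g) <= sgb (~~ c.2) * expect c.1.1 c.1.2 g).
  by case: c.2 => /=; rewrite ?mulN1r ?mul1r ?opprK.
by apply/eqP; rewrite eq_le le/=; have := le (- f); rewrite opprK.
Qed.

Lemma bias_norm_ge0 f : 0 <= bias_norm f.
Proof.
by have := sublinear_geN f bias_norm_sublinear; rewrite bias_normN; lra.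
Qed.

Lemma bias_normZ_le c f : bias_norm (c *: f) <= `|c| * bias_norm f.
Proof.
have [c0|c0|->] := ltgtP c 0.
- rewrite -bias_normN -scaleNr ltr0_norm//.
  by apply: sublinearZ_le bias_norm_sublinear _ _ _; rewrite oppr_gt0.
- by rewrite gtr0_norm//; exact: sublinearZ_le bias_norm_sublinear _ _ c0.
- by rewrite scale0r normr0 mul0r (sublinear0 bias_norm_sublinear).
Qed.

Lemma expect_sgb n theta j : (j < n)%N ->
  expect n theta (fun t => sgb (t j)) = sgb (theta j) / 2.
Proof. by move=> jn; rewrite expect_coord//; case: (theta j) => /=; field. Qed.

(** Biasing each coordinate towards the sign of its coefficient gives an expectation equal to half
    the l_1 norm of the coefficients, which dominates the sup norm. *)
Lemma norm_comb_le_bias_norm a n :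
  `|rademacher_comb a n| <= 2 * bias_norm (rademacher_comb a n).
Proof.
apply: (le_trans (normr_rademacher_comb a n)).
rewrite mulrC -ler_pdivrMr//; apply: limsup_sup_ge => m.
pose theta j := 0 <= a j.
exists (maxn m n, theta, true); first exact: leq_maxl.
change ((\sum_(j < n) `|a j|) / 2 <=
  1 * expect (maxn m n) theta (rademacher_comb a n)).
have -> : (rademacher_comb a n : (nat -> bool) -> R) =
    fun t => \sum_(j < n) a j * sgb (t j).
  by apply/funext => t; exact: rademacher_combE.
rewrite mul1r (expect_sum _ _ _ (fun j t => a j * sgb (t j))) mulr_suml.
apply: ler_sum => j _; rewrite expectZ expect_sgb; last first.
  by rewrite (leq_trans (ltn_ord j))// leq_maxr.
rewrite mulrA ler_wpM2r// /theta /sgb.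
have [aj|aj] := leP 0 (a j); first by rewrite mulr1 ger0_norm.
by rewrite mulrN1 ltr0_norm.
Qed.

Definition octa_norm f : R := comb_dist f + bias_norm f.

Lemma octa_norm_le f : octa_norm f <= 2 * `|f|.
Proof.
have := comb_dist_le f 0 (fun=> 0); have := bias_norm_le_norm f.
by rewrite /octa_norm /rademacher_comb big_ord0 subr0; lra.
Qed.

(* If [f - z] is small with [z] in the span of the Rademacher functions, then
   [|z| <= 2 bias_norm z <= 2 (bias_norm f + |f - z|)]. *)
Lemma norm_le_octa_norm f : `|f| <= 3 * octa_norm f.
Proof.
(* The triangle inequality gives [|f| <= 3 |f - z| + 2 bias_norm f] for every [z] in the span. *)
suff : (`|f| - 2 * bias_norm f) / 3 <= comb_dist f.
  by rewrite /octa_norm; have := bias_norm_ge0 f; lra.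
apply: lb_le_inf; first exact: comb_dists_neq0.
move=> _ [n [a ->]]; set z := rademacher_comb a n.
have := ler_normD (f - z) z; rewrite subrK.
have : `|z| <= 2 * bias_norm z by exact: norm_comb_le_bias_norm.
have := sublinearD bias_norm_sublinear f (z - f).
rewrite addrC subrK; have := bias_norm_le_norm (z - f).
by rewrite distrC; lra.
Qed.

Lemma octa_norm_sublinear : sublinear octa_norm.
Proof.
split=> [f g|c f c0]; rewrite /octa_norm.
  by rewrite addrACA lerD ?(sublinearD comb_dist_sublinear) ?(sublinearD bias_norm_sublinear).
by rewrite mulrDr lerD ?(sublinearZ_le comb_dist_sublinear) ?(sublinearZ_le bias_norm_sublinear).
Qed.

Lemma octa_normZ c f : octa_norm (c *: f) = `|c| * octa_norm f.
Proof.
have le b g : octa_norm (b *: g) <= `|b| * octa_norm g.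
  by rewrite mulrDr lerD ?comb_distZ_le ?bias_normZ_le.
apply/eqP; rewrite eq_le le /=; have [->|c0] := eqVneq c 0.
  by rewrite normr0 mul0r addr_ge0 ?comb_dist_ge0 ?bias_norm_ge0.
by rewrite -ler_pdivlMl ?normr_gt0// -normfV -{1}[f](scalerK c0) le.
Qed.

Lemma octa_norm_equivalent : equivalent_norm octa_norm.
Proof.
split.
- exact: sublinearD octa_norm_sublinear.
- exact: octa_normZ.
- move=> f f0; apply/eqP; rewrite -normr_eq0 eq_le normr_ge0 andbT.
  by rewrite (le_trans (norm_le_octa_norm f))// f0 mulr0.
- exists (1 / 3), 2; split => // f; have := norm_le_octa_norm f.
  by have := octa_norm_le f; lra.
Qed.

Lemma comb_dist_rademacher c j : comb_dist (c *: rademacher j) = 0.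
Proof.
apply/eqP; rewrite eq_le comb_dist_ge0 andbT.
apply: (le_trans (comb_dist_le _ j.+1 (fun i => if i == j then c else 0))).
rewrite /rademacher_comb big_ord_recr/= eqxx big1 ?add0r ?subrr ?normr0// => i _.
by rewrite ltn_eqF ?scale0r.
Qed.

End Norm.

(** * Perturbing a functional one coordinate at a time *)

Section Perturbation.
Variable R : realType.
Local Notation X := (CDelta R).

(** Beyond depth [j] the forced function is constantly 1; bounding it and its opposite by their
    upper limits pins down the value of [m]. *)
Lemma limsup_sup_forced_rademacher (m : {scalar bconfig R}) j :
  (forall g, m g <= limsup_sup g) ->
  m (forced j (signed_expect (2 *: rademacher R j))) = 1.
Proof.
move=> mL; set g := forced _ _.
have gE c : (j < c.1.1)%N -> g c = 1.
  move=> jc; change (sgb R c.2 * expect c.1.1 (upd c.1.2 j c.2)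
    (fun t => 2 * sgb R (t j)) = 1).
  by rewrite expectZ expect_sgb// upd_eq; case: c.2 => /=; field.
apply/eqP; rewrite eq_le; apply/andP; split.
  by rewrite (le_trans (mL g))//; apply: (@limsup_sup_le _ _ _ j.+1) => c /gE ->.
rewrite -lerN2 -raddfN (le_trans (mL _))//.
apply: (@limsup_sup_le _ _ _ j.+1) => c /gE gc.
by change (- g c <= -1); rewrite gc.
Qed.

(** At depth at least [k ^ 2] the sum is, up to sign, the expectation of [f] against a [tilt_sum],
    so cancellation leaves order [k] out of [k ^ 2] terms. *)
Lemma forced_sub_sum_le (f : X) (b : nat -> R) k : (forall j, `|b j| <= 1) ->
  limsup_sup (\sum_(j < k ^ 2) b j *: (forced j (signed_expect f) - signed_expect f))
    <= 2 * `|f| * k%:R.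
Proof.
move=> b1; apply: (@limsup_sup_le _ _ _ (k ^ 2)) => -[[n theta] s] /= kn.
have -> n' : (\sum_(j < n') b j *: (forced j (signed_expect f) - signed_expect f))
      (n, theta, s) =
    \sum_(j < n') b j * (sgb R s * expect n (upd theta j s) f - sgb R s * expect n theta f).
  elim: n' => [|n' IH]; first by rewrite !big_ord0.
  by rewrite !big_ord_recr/= -IH.
have := expect_tilt_sum_le theta (fun=> s) kn b1 (le_sup_norm f).
apply: le_trans; rewrite -[leRHS]mul1r -(normr_sgb R s) -normrM.
apply: le_trans (ler_norm _); rewrite le_eqVlt; apply/orP; left; apply/eqP.
pose F j t := b j * (f t * tilt R (theta j) s (t j) + (-1) * f t).
have -> : (fun t => f t * tilt_sum theta (fun=> s) b (k ^ 2) t) =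
    (fun t => \sum_(j < k ^ 2) F j t).
  by apply/funext => t; rewrite mulr_sumr; apply: eq_bigr => j _; rewrite /F; ring.
rewrite (expect_sum n theta _ F) mulr_sumr; apply: eq_bigr => j _.
rewrite expectZ expectD expectZ -expect_upd; first by ring.
exact: leq_trans (ltn_ord j) kn.
Qed.

(* By Hahn-Banach, phi = a + m o signed_expect with a <= comb_dist and m dominated
   by limsup_sup; psi j forces the j-th coordinate to agree with the sign in m. *)
Theorem perturbation (phi : {scalar X}) : (forall f, phi f <= octa_norm f) ->
  exists psi : nat -> {scalar X}, [/\
    forall j f, psi j f <= octa_norm f,
    forall j, psi j (2 *: rademacher R j) = 1 &
    forall k (b : nat -> R) f, (forall j, `|b j| <= 1) ->
      \sum_(j < k ^ 2) b j * (psi j f - phi f) <= 2 * `|f| * k%:R].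
Proof.
move=> phiN.
(* The infimum of [E g] is an infimal convolution. For a linear minorant [m], [h = 0] gives
   [m <= limsup_sup], while [g = - signed_expect f] and [h = f] bound [phi f - m (signed_expect f)]
   by [comb_dist f]. *)
pose E (g : bconfig R) : set R := [set r | exists h : X,
  r = limsup_sup (g + signed_expect h) + comb_dist h - phi h].
have sL := limsup_sup_sublinear R; have sd := comb_dist_sublinear R.
have lE g : has_lbound (E g).
  exists (- limsup_sup (- g)) => _ [h ->].
  have := sublinearD sL (g + signed_expect h) (- g); rewrite addrAC subrr add0r.
  by have := phiN h; rewrite /octa_norm /bias_norm; lra.
have sE : sublinear (fun g => inf (E g)).
  apply: inf_sublinear => //.
  - by move=> g; eexists; exists 0.
  - move=> g g' _ _ [h ->] [h' ->]; eexists; first by exists (h + h').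
    rewrite [phi _]raddfD [signed_expect (h + h')]raddfD [leRHS]addrACA opprD lerD2r.
    by rewrite [leRHS]addrACA [X in limsup_sup X]addrACA lerD ?(sublinearD sL) ?(sublinearD sd).
  - move=> a g _ a0 [h ->]; eexists; first by exists (a *: h).
    rewrite [phi _]linearZ [signed_expect (a *: h)]linearZ -scalerDr mulrBr lerD2r mulrDr.
    by rewrite lerD ?(sublinearZ_le sL) ?(sublinearZ_le sd).
have [m mE] := hahn_banach sE.
have mL g : m g <= limsup_sup g.
  rewrite (le_trans (mE g))//; apply: ge_inf => //; exists 0.
  by rewrite !raddf0 addr0 (sublinear0 sd) !addr0.
have md f : phi f - m (signed_expect f) <= comb_dist f.
  have : m (- signed_expect f) <= comb_dist f - phi f.
    rewrite (le_trans (mE _))//; apply: ge_inf => //; exists f.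
    by rewrite addNr (sublinear0 sL) add0r.
  by rewrite raddfN; lra.
pose psi_fun j f : R := phi f - m (signed_expect f) + m (forced j (signed_expect f)).
have psi_lin j : scalar (psi_fun j).
  move=> a f g; rewrite /psi_fun [phi _]linearP [signed_expect (_ + _)]linearP.
  by rewrite [forced j (_ + _)]linearP !(linearP m)/=; ring.
pose psi j : {scalar X} :=
  HB.pack (psi_fun j) (GRing.isLinear.Build R X R *%R (psi_fun j) (psi_lin j)).
exists psi; split.
- by move=> j f; rewrite lerD// (le_trans (mL _))// limsup_sup_forced.
- move=> j; change (psi_fun j (2 *: rademacher R j) = 1).
  rewrite /psi_fun limsup_sup_forced_rademacher//.
  (* Both multiples are at distance 0 from the span, so the part of [phi] dominated by [comb_dist]
     vanishes on them. *)
  have := md (2 *: rademacher R j); have := md (- 2 *: rademacher R j).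
  by rewrite !comb_dist_rademacher scaleNr !raddfN/=; lra.
- move=> k b f b1; apply: le_trans (forced_sub_sum_le f k b1).
  apply: le_trans (mL _); rewrite raddf_sum/= ler_sum// => j _.
  rewrite linearZ raddfB /psi_fun /=.
  by rewrite le_eqVlt; apply/orP; left; apply/eqP; ring.
Qed.

End Perturbation.

(** * Finite nets for the bounded part of a finite-dimensional span *)

Section FiniteDimensional.
Variables (R : realType) (X : normedModType R).

(* If the last generator is at positive distance from the span of the others, its
   coefficient is bounded by the norm; otherwise it can be dispensed with. *)
Lemma span_net n (v : 'I_n -> X) M e : 0 < e -> exists s : seq X,
  forall c : 'I_n -> R, `|\sum_(i < n) c i *: v i| <= M ->
  exists2 u, u \in s & `|\sum_(i < n) c i *: v i - u| <= e.
Proof.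
elim: n v M e => [|n IH] v M e e0.
  by exists [:: 0] => c _; exists 0; rewrite ?mem_head// big_ord0 subrr normr0 ltW.
pose v' i := v (widen_ord (leqnSn n) i); pose w := v ord_max.
have e2 : 0 < e / 2 by rewrite divr_gt0.
have [[d d0 wd]|wE] := pselect (exists2 d, 0 < d &
    forall c : 'I_n -> R, d <= `|\sum_(i < n) c i *: v' i + w|); last first.
  have [s sP] := IH v' (M + e / 2) (e / 2) e2; exists s => c.
  rewrite big_ord_recr/= -/w; set x := _ + _ => xM.
  (* Here [- w] is approximable by the other generators; this tolerance keeps the error at most
     [e / 2] after scaling by the coefficient of [w], and [+ 1] avoids a zero denominator. *)
  have t0 : 0 < e / 2 / (`|c ord_max| + 1) by rewrite divr_gt0// ltr_wpDl.
  have [a] : exists a : 'I_n -> R,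
      `|\sum_(i < n) a i *: v' i + w| < e / 2 / (`|c ord_max| + 1).
    apply: contrapT => /forallNP aE; apply: wE; eexists; first exact: t0.
    by move=> a; rewrite leNgt; apply/negP; exact: aE.
  rewrite ltr_pdivlMr ?ltr_wpDl// => wa.
  pose z := \sum_(i < n) (c (widen_ord (leqnSn n) i) - c ord_max * a i) *: v' i.
  have xz : `|x - z| <= e / 2.
    have -> : x - z = c ord_max *: (\sum_(i < n) a i *: v' i + w).
      rewrite /x /z scalerDr scaler_sumr addrAC -sumrB; congr (_ + _).
      by apply: eq_bigr => i _; rewrite scalerBl scalerA opprB addrCA subrr addr0.
    rewrite normrZ (le_trans _ (ltW wa))// mulrC ler_wpM2l//.
    by rewrite lerDl.
  have zM : `|z| <= M + e / 2.
    by rewrite -[z](subrK x) addrC (le_trans (ler_normD _ _))// lerD// distrC.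
  have [u us zu] := sP _ zM; exists u => //.
  rewrite -(subrK z x) -addrA (le_trans (ler_normD _ _))//.
  by rewrite [e]splitr lerD.
have [M0|M0] := ltP M 0.
  by exists [::] => c cM; have := le_trans (normr_ge0 _) cM; rewrite leNgt M0.
(* [T] bounds the coefficient [t] of [w], the vector having norm at least [|t| d]. The points [g k]
   below form a grid of step [h] covering [-T, T], and [h |w| <= e / 2]. *)
pose T := M / d; pose h := e / 2 / (`|w| + 1).
have T0 : 0 <= T by rewrite divr_ge0// ltW.
have h0 : 0 < h by rewrite divr_gt0// ltr_wpDl.
pose g k : R := k%:R * h - T.
have [s sP] := IH v' (M + T * `|w|) (e / 2) e2.
have [ks ksP] : exists ks : seq nat, forall k, (k <= Num.truncn (2 * T / h))%N -> k \in ks.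
  by exists (iota 0 (Num.truncn (2 * T / h)).+1) => k; rewrite mem_iota.
exists [seq u + g k *: w | u <- s, k <- ks] => c.
rewrite big_ord_recr/= -/w; set y := \sum_(i < n) _; set t := c ord_max => xM.
have tT : `|t| <= T.
  have [->|t0] := eqVneq t 0; first by rewrite normr0.
  rewrite ler_pdivlMr// (le_trans _ xM)//.
  have -> : y + t *: w =
      t *: (\sum_(i < n) (t^-1 * c (widen_ord (leqnSn n) i)) *: v' i + w).
    rewrite scalerDr scaler_sumr; congr (_ + _); apply: eq_bigr => i _.
    by rewrite scalerA mulrA divff// mul1r.
  by rewrite normrZ ler_wpM2l.
have yM : `|y| <= M + T * `|w|.
  rewrite -[y](addrK (t *: w)) (le_trans (ler_normB _ _))// lerD// normrZ.
  by rewrite ler_wpM2r.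
have [u us yu] := sP _ yM.
pose k := Num.truncn ((t + T) / h).
move: tT; rewrite ler_norml => /andP[tT1 tT2].
have tT0 : 0 <= (t + T) / h by rewrite divr_ge0 ?(ltW h0)//; lra.
have /andP[k1 k2] := truncn_itv tT0.
exists (u + g k *: w).
  apply/allpairsPdep; exists u, k; split=> //; apply: ksP.
  by apply: le_truncn; rewrite ler_pM2r ?invr_gt0//; lra.
rewrite opprD addrACA (le_trans (ler_normD _ _))// [e]splitr lerD//.
rewrite -scalerBl normrZ.
have tk : `|t - g k| <= h.
  rewrite ler_pdivlMr// in k1; rewrite ltr_pdivrMr// -natr1 in k2.
  by rewrite ler_norml /g; apply/andP; split; lra.
apply: (le_trans (ler_wpM2r (normr_ge0 w) tk)).
rewrite /h mulrAC ler_pdivrMr ?ltr_wpDl// ler_wpM2l ?(ltW e2)//.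
by rewrite lerDl.
Qed.

End FiniteDimensional.

(** * Bounded functionals and the canonical map into the bidual *)

Section Bidual.
Variables (R : realType) (Y : normedModType R).

Lemma bounded_in_dual (f : Y -> R^o) M :
  linear f -> (forall x, `|f x| <= M * `|x|) -> f \in @dual_pred R Y.
Proof.
move=> f_lin fM; apply/asboolT; split=> //.
pose f' : {linear Y -> R^o} := HB.pack f (GRing.isLinear.Build _ _ _ _ f f_lin).
suff : continuous f' by [].
apply/linear_bounded_continuous/bounded_funP => r; exists (`|M| * r) => x xr.
by rewrite (le_trans (fM x))// (le_trans (ler_wpM2r _ (ler_norm M)))// ler_wpM2l.
Qed.


Definition bounded_dual f M (f_lin : linear f) (fM : forall x, `|f x| <= M * `|x|) :
  dual_space Y := Dual (bounded_in_dual f_lin fM).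

Lemma norm_bounded_dual f M (f_lin : linear f) (fM : forall x, `|f x| <= M * `|x|) :
  0 <= M -> `|bounded_dual f_lin fM| <= M.
Proof.
move=> M0; apply: dual_norm_le => x x1; rewrite (le_trans (fM x))//.
by rewrite -[leRHS]mulr1 ler_wpM2l.
Qed.

Lemma normr_dual_le (phi : dual_space Y) y : `|phi y| <= `|phi| * `|y|.
Proof. exact: le_dual_norm. Qed.

Lemma dual_sumE (u : nat -> dual_space Y) n y :
  (\sum_(j < n) u j) y = \sum_(j < n) u j y.
Proof.
elim: n => [|n IH]; first by rewrite !big_ord0.
by rewrite !big_ord_recr/= -IH.
Qed.

End Bidual.

Section Evaluation.
Variables (R : realType) (Y : normedModType R).

Lemma evaluation_linear (y : Y) : linear (fun phi : dual_space Y => phi y : R^o).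
Proof. by []. Qed.

Lemma evaluation_le (y : Y) (phi : dual_space Y) : `|phi y| <= `|y| * `|phi|.
Proof. by rewrite mulrC; exact: normr_dual_le. Qed.

Definition evaluation (y : Y) : dual_space (dual_space Y) :=
  bounded_dual (@evaluation_linear y) (@evaluation_le y).

Lemma norm_evaluation_le y : `|evaluation y| <= `|y|.
Proof. exact: norm_bounded_dual. Qed.

Lemma dual_norming (F : dual_space Y) e : 0 < e ->
  exists2 y : Y, `|y| <= 1 & `|F| - e < F y.
Proof.
move=> e0; have [_ [y /= y1 <-] Fy] := sup_adherent e0 (dual_norm_has_sup F).
have [Fy0|Fy0] := leP 0 (F y).
  by exists y => //; move: Fy; rewrite ger0_norm.
exists (- y); rewrite ?normrN//.
suff -> : F (- y) = - F y by move: Fy; rewrite ltr0_norm.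
pose F' : {scalar Y} := HB.pack (F : Y -> R)
  (GRing.isLinear.Build R Y R *%R (F : Y -> R) (@dual_linear _ _ F)).
exact: (raddfN F').
Qed.

End Evaluation.

(** Otherwise the first [k ^ 2] terms sum to at least [k ^ 2 e], which exceeds [C k] as soon as
    [k e > |C|]. *)
Lemma small_term (R : realType) (d : nat -> R) C e : 0 < e ->
  (forall k, \sum_(j < k ^ 2) d j <= C * k%:R) -> exists j, d j <= e.
Proof.
move=> e0 dC; apply: contrapT => /forallNP de.
pose k := (Num.truncn (`|C| / e)).+1.
have kC : `|C| < k%:R * e by rewrite -ltr_pdivrMr// truncnS_gt.
have : (k ^ 2)%:R * e <= \sum_(j < k ^ 2) d j.
  rewrite -[X in X%:R]card_ord -sumr_const mulr_suml; apply: ler_sum => j _.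
  by rewrite mul1r ltW// ltNge; apply/negP; exact: de.
move=> /le_trans/(_ (dC k)); rewrite natrX expr2 -mulrA mulrC ler_pM2r ?ltr0Sn//.
by have := ler_norm C; lra.
Qed.

(** * Octahedrality of the bidual norm *)

Section OctahedralBidual.
Variable R : realType.
Local Notation Y := (renormed (octa_norm_equivalent R)).
Local Notation X1 := (dual_space Y).
Local Notation X2 := (dual_space X1).

(** The factor 2 normalises: biased means of a Rademacher function are +1/2 or -1/2. *)
Definition peak j : X2 := evaluation (2 *: rademacher R j : Y).

Lemma dual_of_le_octa_norm (psi : {scalar (CDelta R)}) :
  (forall f, psi f <= octa_norm f) ->
  exists2 Psi : X1, `|Psi| <= 1 & forall f, Psi f = psi f.
Proof.
move=> psiN; have psi1 (f : Y) : `|psi f| <= 1 * `|f|.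
  rewrite mul1r -[leRHS]/(octa_norm f) ler_norml psiN andbT lerNl -raddfN.
  by rewrite (le_trans (psiN _))// -scaleN1r octa_normZ normrN1 mul1r.
have psi_lin : linear (psi : Y -> R^o) by exact: linearP.
exists (bounded_dual psi_lin psi1) => //; exact: norm_bounded_dual.
Qed.

Lemma dual_perturbation (Phi : X1) : `|Phi| <= 1 ->
  exists Psi : nat -> X1, [/\ forall j, `|Psi j| <= 1, forall j, peak j (Psi j) = 1 &
    forall k (b : nat -> R), (forall j, `|b j| <= 1) ->
      `|\sum_(j < k ^ 2) b j *: (Psi j - Phi)| <= 6 * k%:R].
Proof.
move=> Phi1.
pose phi : {scalar (CDelta R)} := HB.pack (Phi : CDelta R -> R)
  (GRing.isLinear.Build R (CDelta R) R *%R (Phi : CDelta R -> R) (@dual_linear _ _ Phi)).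
have [f|psi [psiN psi1 psi_sum]] := @perturbation R phi.
  rewrite (le_trans (ler_norm _))// (le_trans (normr_dual_le Phi (f : Y)))//.
  by rewrite -[leRHS]mul1r ler_wpM2r.
have /choice[Psi PsiP] j : exists Psi : X1, `|Psi| <= 1 /\ forall f, Psi f = psi j f.
  by have [Psi] := dual_of_le_octa_norm (psiN j); exists Psi.
exists Psi; split.
- by move=> j; have [] := PsiP j.
- by move=> j; rewrite -(psi1 j); have [_] := PsiP j; exact.
- move=> k b b1; apply: dual_norm_le => f f1.
  rewrite (dual_sumE (fun j => b j *: (Psi j - Phi))).
  rewrite (eq_bigr (fun j : 'I_(k ^ 2) => b j * (psi j f - phi f))); last first.
    by move=> j _; rewrite -(PsiP j).2.
  (* The unit ball of [octa_norm] lies in the sup-norm ball of radius 3, whence the constant 6 = 2 *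
     3. *)
  have f3 : `|f : CDelta R| <= 3.
    by rewrite (le_trans (norm_le_octa_norm f))// -[leRHS]mulr1 ler_wpM2l.
  have f6 : 2 * `|f : CDelta R| * k%:R <= 6 * k%:R.
    by rewrite ler_wpM2r//; lra.
  rewrite ler_norml (le_trans (psi_sum k b f b1))// andbT lerNl -sumrN.
  have := psi_sum k (fun j => - b j) f; rewrite (eq_bigr (fun j : 'I_(k ^ 2) =>
    - (b j * (psi j f - phi f)))); last by move=> j _; rewrite mulNr.
  by move=> H; rewrite (le_trans (H _))// => j; rewrite normrN.
Qed.

(** The lower bound comes from perturbing the zero functional: the resulting [Psi j] lies in the
    unit ball and takes the value 1. *)
Lemma norm_peak j : `|peak j| = 1.
Proof.
apply/eqP; rewrite eq_le; apply/andP; split.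
  rewrite (le_trans (norm_evaluation_le _))// -[`|_|]/(octa_norm (2 *: rademacher R j)).
  rewrite /octa_norm comb_dist_rademacher add0r.
  apply: (@limsup_sup_le _ _ _ j.+1) => c jc.
  change (sgb R c.2 * expect c.1.1 c.1.2 (fun t => 2 * sgb R (t j)) <= 1).
  rewrite expectZ expect_sgb// /sgb; case: c.2; case: (c.1.2 j); lra.
have [|Psi [/(_ j) Psi1 /(_ j) peak1 _]] := @dual_perturbation 0.
  by rewrite normr0.
have := normr_dual_le (peak j) (Psi j); rewrite peak1 normr1 => /le_trans; apply.
by rewrite -[leRHS]mulr1 ler_wpM2l.
Qed.

(** Take [Phi] nearly norming [F] and test [F + peak j] on its perturbation [Psi j]; the loss is
    [d j = |F (Psi j - Phi)|]. *)
Lemma norm_add_peak (F : X2) e : 0 < e -> exists d : nat -> R,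
  [/\ forall j, 0 <= d j, exists C, forall k, \sum_(j < k ^ 2) d j <= C * k%:R &
    forall j, `|F| + 1 - e - d j <= `|F + peak j|].
Proof.
move=> e0; have [Phi Phi1 FPhi] := dual_norming F e0.
have [Psi [Psi1 peak1 Psi_sum]] := dual_perturbation Phi1.
pose F' : {scalar X1} := HB.pack (F : X1 -> R)
  (GRing.isLinear.Build R X1 R *%R (F : X1 -> R) (@dual_linear _ _ F)).
exists (fun j => `|F' (Psi j - Phi)|); split=> // [|j].
  exists (`|F| * 6) => k.
  (* These signs turn the sum of absolute values into [F] at one linear combination, whose norm is
     at most [6 * k%:R]. *)
  pose b j : R := Num.sg (F' (Psi j - Phi)).
  have -> : \sum_(j < k ^ 2) `|F' (Psi j - Phi)| =
      F' (\sum_(j < k ^ 2) b j *: (Psi j - Phi)).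
    by rewrite raddf_sum; apply: eq_bigr => j _; rewrite normrEsg [RHS]linearZ.
  rewrite (le_trans (ler_norm _))// (le_trans (normr_dual_le F _))// -mulrA.
  rewrite ler_wpM2l// Psi_sum// => i; rewrite /b normr_sg.
  by case: (_ != 0).
have : F (Psi j) + 1 <= `|F + peak j|.
  rewrite -(peak1 j) -[leLHS]/((F + peak j) (Psi j)) (le_trans (ler_norm _))//.
  rewrite (le_trans (normr_dual_le _ _))//.
  by rewrite -[leRHS]mulr1 ler_wpM2l.
have F_sub : F' (Psi j - Phi) = F (Psi j) - F Phi by exact: (raddfB F').
have := ler_norm (- F' (Psi j - Phi)); rewrite normrN.
by lra.
Qed.

(** The error sequences of the members of [s] add up to one that still has partial sums of order
    [k], so a single small term serves all of them. *)
Lemma norm_add_peak_seq (s : seq X2) e : 0 < e ->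
  exists j, forall F, F \in s -> `|F| + 1 - e <= `|F + peak j|.
Proof.
move=> e0; have e2 : 0 < e / 2 by rewrite divr_gt0.
suff [d [_ [C dC] sd]] : exists d : nat -> R,
    [/\ forall j, 0 <= d j, exists C, forall k, \sum_(j < k ^ 2) d j <= C * k%:R &
      forall F j, F \in s -> `|F| + 1 - e / 2 - d j <= `|F + peak j|].
  have [j dj] := small_term e2 dC; exists j => F /(sd _ j); lra.
elim: s => [|F s [d [d0 [C dC] sd]]].
  by exists (fun=> 0); split=> //; exists 0 => k; rewrite mul0r big1.
have [d' [d'0 [C' dC'] sd']] := norm_add_peak F e2.
exists (fun j => d j + d' j); split.
- by move=> j; rewrite addr_ge0.
- by exists (C + C') => k; rewrite big_split mulrDl lerD.
- move=> G j; rewrite inE => /predU1P[->|/(sd _ j)].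
    by apply: le_trans (sd' j); have := d0 j; lra.
  by apply: le_trans; have := d'0 j; lra.
Qed.

Lemma octahedral_bidual : octahedral X2.
Proof.
move=> E e [n [v ->]] e0.
(* Three errors of [e / 4] occur: two from replacing [x] by a net point [u], one from adding the
   peak to [u]. *)
have e4 : 0 < e / 4 by rewrite divr_gt0.
have [s sP] := span_net v (2 / e) e4.
have [j jP] := norm_add_peak_seq s e4.
exists (peak j); first exact: norm_peak.
rewrite norm_peak => _ [c _ <-]; set x := \sum_(i < n) _.
(* For [|x| > 2 / e] the triangle inequality suffices: [e |x| > 2] absorbs the loss in
   [|x + y| >= |x| - 1]. *)
have [xM|xM] := leP `|x| (2 / e); last first.
  rewrite ltr_pdivrMr// in xM; have := ler_normB (x + peak j) (peak j).
  by rewrite addrK norm_peak; nra.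
have [u us xu] := sP c xM; rewrite -/x in xu.
have := ler_normB (x + peak j) (x - u); rewrite opprB addrACA.
have -> : x + u + (peak j - x) = u + peak j.
  by rewrite addrC addrA subrK addrC.
have := ler_normD (x - u) u; rewrite subrK.
have := jP u us; have : 0 <= e * `|x| by rewrite mulr_ge0// ltW.
by lra.
Qed.

End OctahedralBidual.

Theorem theorem4p1 (R : realType) :
  exists (N : CDelta R -> R) (hN : equivalent_norm N),
    octahedral (dual_space (dual_space (renormed hN))).
Proof. by exists (@octa_norm R), (octa_norm_equivalent R); exact: octahedral_bidual. Qed.
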